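(* Up to equivalence, the only $0,1$ matrix $M$ of size $6\times 6$ with $\mathrm{rank}_{\mathbb{R}}(M) = 4$ and $\mathrm{rank}_{\mathrm{bin}}(M) = \mathrm{rank}_{\mathbb{B}}(M) = i(M) = 6$ is the circulant matrix $$C_6 = \begin{pmatrix} 1&1&1&0&0&0\\ 0&1&1&1&0&0\\ 0&0&1&1&1&0\\ 0&0&0&1&1&1\\ 1&0&0&0&1&1\\ 1&1&0&0&0&1\end{pmatrix}.$$
   Context: Two matrices are equivalent if one can be obtained from the other by permuting rows, permuting columns, and possibly transposing. $\mathrm{rank}_{\mathbb{R}}(M)$ is the usual rank over $\mathbb{R}$. For a $0,1$ matrix $M$ of size $n\times m$, the binary rank $\mathrm{rank}_{\mathrm{bin}}(M)$ is the minimal $d$ for which there are $0,1$ matrices $A$ ($n\times d$) and $B$ ($d\times m$) with $M = A\cdot B$ over the integers; equivalently, the minimum number of all-one combinatorial rectangles (submatrices all of whose entries are $1$) needed to partition the ones of $M$. The Boolean rank $\mathrm{rank}_{\mathbb{B}}(M)$ is defined in the same way with Boolean arithmetic ($1+1=1$); equivalently, the minimum number of all-one combinatorial rectangles needed to cover the ones of $M$ (overlaps allowed). An isolation set of $M$ is a set of $1$-entries of $M$ such that no two of them are in the same row or column and no two of them belong to an all-one $2\times 2$ submatrix of $M$; $i(M)$ is the maximum size of an isolation set of $M$. *)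

(* Defs.v *)
From HB Require Import structures.
From mathcomp Require Import all_boot all_order all_fingroup all_algebra reals.

Set Implicit Arguments.
Unset Strict Implicit.
Unset Printing Implicit Defensive.

Import GRing.Theory.

Local Open Scope ring_scope.

(* A 0,1 matrix is a matrix over bool. The ring structure that MathComp puts on
   bool is that of F_2 and is never used here: arithmetic takes place either
   over a ring R, through [mx01 R], or with the Boolean product [bmulmx]. *)
Definition mx01 (R : nzRingType) (m n : nat) (M : 'M[bool]_(m, n)) :
    'M[R]_(m, n) :=
  map_mx (fun b : bool => (nat_of_bool b)%:R) M.

Definition bmulmx (m d n : nat) (A : 'M[bool]_(m, d)) (B : 'M[bool]_(d, n)) :
    'M[bool]_(m, n) :=
  \matrix_(i < m, j < n) [exists k : 'I_d, A i k && B k j].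

Definition real_rank (R : realType) (m n : nat) (M : 'M[bool]_(m, n)) : nat :=
  \rank (mx01 R M).

Definition bin_factor (m n : nat) (M : 'M[bool]_(m, n)) (d : nat) : bool :=
  [exists A : 'M[bool]_(m, d), exists B : 'M[bool]_(d, n),
    mx01 int M == mx01 int A *m mx01 int B].

Definition bool_factor (m n : nat) (M : 'M[bool]_(m, n)) (d : nat) : bool :=
  [exists A : 'M[bool]_(m, d), exists B : 'M[bool]_(d, n), M == bmulmx A B].

Lemma bin_factor_ex (m n : nat) (M : 'M[bool]_(m, n)) :
  exists d, bin_factor M d.
Proof.
exists m; apply/existsP; exists (\matrix_(i, j) (i == j)).
apply/existsP; exists M; apply/eqP.
suff -> : mx01 int (\matrix_(i < m, j < m) (i == j)) = 1%:M by rewrite mul1mx.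
by apply/matrixP => i j; rewrite !mxE.
Qed.

Lemma bool_factor_ex (m n : nat) (M : 'M[bool]_(m, n)) :
  exists d, bool_factor M d.
Proof.
exists m; apply/existsP; exists (\matrix_(i, j) (i == j)).
apply/existsP; exists M; apply/eqP/matrixP => i j; rewrite !mxE.
apply/idP/existsP => [Mij | [k]]; first by exists i; rewrite mxE eqxx.
by rewrite mxE => /andP[/eqP->].
Qed.

Definition bin_rank (m n : nat) (M : 'M[bool]_(m, n)) : nat :=
  ex_minn (bin_factor_ex M).

Definition bool_rank (m n : nat) (M : 'M[bool]_(m, n)) : nat :=
  ex_minn (bool_factor_ex M).

Definition all_one_submx (m n : nat) (M : 'M[bool]_(m, n))
    (I : {set 'I_m}) (J : {set 'I_n}) : bool :=
  [forall i in I, forall j in J, M i j].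

Definition in_all_one_2x2 (m n : nat) (M : 'M[bool]_(m, n))
    (p q : 'I_m * 'I_n) : bool :=
  [exists I : {set 'I_m}, exists J : {set 'I_n},
    [&& #|I| == 2%N, #|J| == 2%N, all_one_submx M I J,
        p \in setX I J & q \in setX I J]].

Definition isolation_set (m n : nat) (M : 'M[bool]_(m, n))
    (S : {set 'I_m * 'I_n}) : bool :=
  [forall p in S, M p.1 p.2] &&
  [forall p in S, forall q in S, (p != q) ==>
    [&& p.1 != q.1, p.2 != q.2 & ~~ in_all_one_2x2 M p q]].

Definition isolation_number (m n : nat) (M : 'M[bool]_(m, n)) : nat :=
  \max_(S : {set 'I_m * 'I_n} | isolation_set M S) #|S|.

Definition equiv_mx (n : nat) (M N : 'M[bool]_n) : Prop :=
  exists s t : 'S_n,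
    M = row_perm s (col_perm t N) \/ M = row_perm s (col_perm t N^T).

Definition C6 : 'M[bool]_6 :=
  \matrix_(i < 6, j < 6)
    (nth 0%N (nth [::]
       [:: [:: 1; 1; 1; 0; 0; 0];
           [:: 0; 1; 1; 1; 0; 0];
           [:: 0; 0; 1; 1; 1; 0];
           [:: 0; 0; 0; 1; 1; 1];
           [:: 1; 0; 0; 0; 1; 1];
           [:: 1; 1; 0; 0; 0; 1]]%N i) j == 1%N).

(* Main.v *)
Require Import Defs.
From mathcomp Require Import all_boot all_order all_fingroup all_algebra reals.
From mathcomp Require Import ring lra zify.

(** An isolation set of size 6 in a 6 x 6 matrix meets every row and every column once, so
    a permutation of the columns moves it to the diagonal. After that M has a unit diagonal
    and never M i j = M j i = 1 for i != j: it is the identity plus the adjacency matrix of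
    an oriented graph on six vertices ([oriented]). It remains to see that rank 4 forces this
    graph to be the one of [C6], in which p_a has arcs to p_(a+1) and p_(a+2) (mod 6).

    The graph contains a chordless directed 4-cycle ([exists_chordless4]). Otherwise every
    principal 4 x 4 minor is 1, 2 or 3. Since M = X Y with X of size 6 x 4 and Y of size
    4 x 6, such a minor is the product of a maximal minor of X and one of Y, and the maximal
    minors of X, and those of Y, satisfy the three-term Pluecker relations. Eliminating
    between the two relations shows that a polynomial in the principal minors is a perfect
    square ([heron_pminor4]), which leaves so few values that exactly two of the six minors
    involved are equal to 2 ([two_twos]). Fix a vertex e and let N be the number of 3-subsets
    of the other vertices that together with e give a minor equal to 2. For each of
    the five vertices f other than e exactly two of these 3-subsets contain f, so 3 N = 10,
    which is absurd.

    Let i j k l be the cycle and x y the other two vertices. The cycle block has rank 3 and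
    its kernels are spanned by the alternating vector (1, -1, 1, -1); as the whole matrix has
    rank 4 only, the out-neighbourhoods of x and y on the cycle are both orthogonal to this
    vector, or the in-neighbourhoods are ([balanced_outs_or_ins]). Transposing if necessary,
    suppose the former. Then M has a kernel vector w with (w x, w y) != 0, and the rows of x
    and y say that w x = c * w y and w y = c' * w x for integers c and c' read off from the
    arcs at x and y. Hence c * c' = 1, and a finite check of the possible arcs leaves
    the graph of [C6] only ([balanced_outs_equiv_C6]).

    Conversely the diagonal of [C6] is an isolation set, an isolation set bounds the Boolean
    rank from below ([bool_factor_isolation]), the Boolean rank is at most the binary rank,
    and that is at most the number of rows; the rank of [C6] is a direct computation. *)

Set Implicit Arguments.
Unset Strict Implicit.
Unset Printing Implicit Defensive.

Import Order.TTheory GRing.Theory Num.Theory.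

Local Open Scope ring_scope.

(** * Four by four determinants *)

Definition minor2 (R : comNzRingType) (f : nat -> nat -> R) (k l p q : nat) : R :=
  f k p * f l q - f k q * f l p.

(** Laplace expansion along the first two rows. A polynomial in the sixteen entries, rather
    than [determinant], lets [ring] prove the identities below and [vm_compute] evaluate it. *)
Definition det4 (R : comNzRingType) (f : nat -> nat -> R) : R :=
    minor2 f 0 1 0 1 * minor2 f 2 3 2 3 - minor2 f 0 1 0 2 * minor2 f 2 3 1 3
  + minor2 f 0 1 0 3 * minor2 f 2 3 1 2 + minor2 f 0 1 1 2 * minor2 f 2 3 0 3
  - minor2 f 0 1 1 3 * minor2 f 2 3 0 2 + minor2 f 0 1 2 3 * minor2 f 2 3 0 1.

Lemma det4_ext (R : comNzRingType) (f g : nat -> nat -> R) :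
  (forall i j, (i < 4)%N -> (j < 4)%N -> f i j = g i j) -> det4 f = det4 g.
Proof. by move=> fg; rewrite /det4 /minor2 !fg. Qed.

Lemma det4M (R : comNzRingType) (f g : nat -> nat -> R) :
  det4 (fun i j => \sum_(0 <= k < 4) f i k * g k j) = det4 f * det4 g.
Proof. by rewrite /det4 /minor2 unlock /=; ring. Qed.

Lemma det4_tr (R : comNzRingType) (f : nat -> nat -> R) :
  det4 (fun i j => f j i) = det4 f.
Proof. by rewrite /det4 /minor2; ring. Qed.

Lemma rmorph_det4 (R S : comNzRingType) (h : {rmorphism R -> S}) (f : nat -> nat -> R) :
  h (det4 f) = det4 (fun i j => h (f i j)).
Proof. by rewrite /det4 /minor2 !(rmorphB, rmorphD, rmorphM). Qed.

(** The three-term Pluecker relation between the maximal minors of a matrix with four columns. *)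
Lemma plucker (R : comNzRingType) (e f a b c d : nat -> R) :
  let D p q r s := det4 (fun i => nth p [:: p; q; r; s] i) in
  D e f a b * D e f c d - D e f a c * D e f b d + D e f a d * D e f b c = 0.
Proof. by rewrite /det4 /minor2 /=; ring. Qed.

(** * Oriented graphs and their principal minors *)

Definition oriented n (M : 'M[bool]_n) : Prop :=
  (forall i, M i i) /\ (forall i j, i != j -> ~~ (M i j && M j i)).

Definition chordless4 (T : Type) (r : T -> T -> bool) (i j k l : T) : bool :=
  [&& r i j, r j k, r k l, r l i, ~~ r i k, ~~ r k i, ~~ r j l & ~~ r l j].

(** Between two vertices of an oriented graph there is no arc, an arc forward, or an arc
    backward. A statement on graphs with n pairs of vertices is checked over these 3 ^ n
    cases. *)
Fixpoint all_arcs (n : nat) (P : seq (bool * bool) -> bool) : bool :=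
  if n is n'.+1 then
    all (fun a => all_arcs n' (fun s => P (a :: s)))
      [:: (false, false); (true, false); (false, true)]
  else P [::].

Lemma all_arcsP n P : all_arcs n P ->
  forall s, size s = n -> all (fun a => ~~ (a.1 && a.2)) s -> P s.
Proof.
elim: n P => [|n IHn] P /= => [P0 [] // | /and4P[Pff Ptf Pft _] [//|a s] [szs] /=].
case/andP; case: a => [[] []] //= _ s_arcs; exact: (IHn (fun s => P (_ :: s))).
Qed.

(** The pairs of vertices are listed in the order 01, 02, 03, 12, 13, 23; loops are present
    because the graph stands for a matrix with a unit diagonal. *)
Definition arc_graph (s : seq (bool * bool)) (i j : nat) : bool :=
  let a := nth (false, false) s in
  match i, j with
  | 0, 1 => (a 0).1 | 1, 0 => (a 0).2
  | 0, 2 => (a 1).1 | 2, 0 => (a 1).2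
  | 0, 3 => (a 2).1 | 3, 0 => (a 2).2
  | 1, 2 => (a 3).1 | 2, 1 => (a 3).2
  | 1, 3 => (a 4).1 | 3, 1 => (a 4).2
  | 2, 3 => (a 5).1 | 3, 2 => (a 5).2
  | _, _ => true
  end%N.

(** The six lists are the directed 4-cycles on four vertices, started at vertex 0. *)
Definition small_det_or_cycle (r : nat -> nat -> bool) : bool :=
  (det4 (fun i j => (r i j)%:R : int) \in [:: 1; 2; 3]) ||
  has (fun c => chordless4 r 0 (nth 0 c 0) (nth 0 c 1) (nth 0 c 2))
    [:: [:: 1; 2; 3]; [:: 1; 3; 2]; [:: 2; 1; 3];
        [:: 2; 3; 1]; [:: 3; 1; 2]; [:: 3; 2; 1]]%N.

Lemma all_arcs_small_det_or_cycle : all_arcs 6 (fun s => small_det_or_cycle (arc_graph s)).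
Proof. by vm_compute. Qed.

(** The determinant is 1 plus the number of directed 3-cycles minus the number of directed
    4-cycles. Four vertices carry at most two of the former and at most one of the latter, each
    chord of which closes a directed 3-cycle. So the determinant is at most 3, and positive
    unless there is a chordless directed 4-cycle. *)
Lemma small_det_or_cycleP (r : nat -> nat -> bool) :
  (forall i, (i < 4)%N -> r i i) -> (forall i j, (i < j < 4)%N -> ~~ (r i j && r j i)) ->
  small_det_or_cycle r.
Proof.
move=> diag asym.
pose s := [:: (r 0 1, r 1 0); (r 0 2, r 2 0); (r 0 3, r 3 0);
              (r 1 2, r 2 1); (r 1 3, r 3 1); (r 2 3, r 3 2)]%N.
have Es i j : (i < 4)%N -> (j < 4)%N -> arc_graph s i j = r i j.
  by case: i => [|[|[|[|]]]] // _; case: j => [|[|[|[|]]]] // _; rewrite diag.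
have sarcs : all (fun a => ~~ (a.1 && a.2)) s by rewrite /= !asym.
have := all_arcsP all_arcs_small_det_or_cycle (s := s) erefl sarcs.
(* [arc_graph s] is abstracted so that rewriting does not try to evaluate it. *)
move: (arc_graph s) Es => g Es; rewrite /small_det_or_cycle.
rewrite (@det4_ext _ _ (fun i j => (r i j)%:R)) => [|? ? ? ?]; last by rewrite Es.
by rewrite /has /chordless4 /nth !Es.
Qed.

Definition quad4 (T : Type) (i j k l : T) : nat -> T := nth i [:: i; j; k; l].

Definition minor4 (R : comNzRingType) n (M : 'M[bool]_n) (s t : nat -> 'I_n) : R :=
  det4 (fun a b => (M (s a) (t b))%:R).

Definition pminor4 (n : nat) (M : 'M[bool]_n) (i j k l : 'I_n) : int :=
  minor4 int M (quad4 i j k l) (quad4 i j k l).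

Lemma pminor4_swap23 n (M : 'M[bool]_n) i j k l : pminor4 M i k j l = pminor4 M i j k l.
Proof. by rewrite /pminor4 /minor4 /det4 /minor2 /=; ring. Qed.

Lemma pminor4_swap34 n (M : 'M[bool]_n) i j k l : pminor4 M i j l k = pminor4 M i j k l.
Proof. by rewrite /pminor4 /minor4 /det4 /minor2 /=; ring. Qed.

Lemma pminor_small n (M : 'M[bool]_n) i j k l : oriented M -> uniq [:: i; j; k; l] ->
    (forall p q r s, uniq [:: p; q; r; s] -> ~~ chordless4 (fun i j => M i j) p q r s) ->
  pminor4 M i j k l \in [:: 1; 2; 3].
Proof.
move=> [Mii Mij] uijkl nocyc.
pose t := quad4 i j k l.
have t_inj p q : (p < 4)%N -> (q < 4)%N -> (t p == t q) = (p == q).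
  by move=> p4 q4; rewrite nth_uniq.
have arc p q : (p < q < 4)%N -> ~~ (M (t p) (t q) && M (t q) (t p)).
  by move=> /andP[pq q4]; rewrite Mij // t_inj ?(ltn_trans pq q4) ?neq_ltn ?pq.
have /orP[//|/hasP[c cP cyc]] :=
  @small_det_or_cycleP (fun a b => M (t a) (t b)) (fun _ _ => Mii _) arc.
have uc : uniq [:: t 0; t (nth 0 c 0); t (nth 0 c 1); t (nth 0 c 2)]%N.
  move: cP; clear -t_inj; rewrite !inE.
  by do ![case/orP]; move=> /eqP-> /=; rewrite !inE !t_inj.
by have := nocyc _ _ _ _ uc; rewrite [chordless4 _ _ _ _ _]cyc.
Qed.

(** * A perfect square built from principal minors *)

(** Heron's polynomial: the opposite of 16 times the squared area of the triangle whose sides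
    are the square roots of x, y and z. *)
Definition heron (R : pzRingType) (x y z : R) : R :=
  x ^+ 2 + y ^+ 2 + z ^+ 2 - (x * y + y * z + x * z) *+ 2.

(** With y = x + z and y' = x' + z', the sum of x * z' and x' * z is y * y' - x * x' - z * z'
    and their product is (x * x') * (z * z'). So Heron's polynomial is the discriminant of
    the quadratic polynomial with roots x * z' and x' * z. *)
Lemma heronE (R : comPzRingType) (x y z x' y' z' : R) :
  x - y + z = 0 -> x' - y' + z' = 0 ->
  heron (x * x') (y * y') (z * z') = (x * z' - x' * z) ^+ 2.
Proof.
have sum_eq (u v w : R) : u - v + w = 0 -> v = u + w.
  by rewrite addrAC => /eqP; rewrite subr_eq0 => /eqP.
by move=> /sum_eq-> /sum_eq->; rewrite /heron; ring.
Qed.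

(** The principal minors are products of a maximal minor of X and one of Y, where M = X Y, so
    [heronE] applies to the Pluecker relations of X and Y. The root k is an integer because
    the products x * z' and x' * z of that lemma are products of mixed minors of M. *)
Lemma heron_pminor4 (F : realFieldType) n (M : 'M[bool]_n) e f a b c d :
    (\rank (mx01 F M) = 4)%N ->
  let g := pminor4 M e f in
  exists k, heron (g a b * g c d) (g a c * g b d) (g a d * g b c) = k ^+ 2.
Proof.
move=> rkM g; have := mulmx_base (mx01 F M).
move: (col_base _) (row_base _); rewrite {}rkM => X Y XY.
pose x i k := X i (inord k); pose y j k := Y (inord k) j.
have Mxy i j : (M i j)%:R = \sum_(0 <= k < 4) x i k * y j k.
  have -> : (M i j)%:R = mx01 F M i j by rewrite mxE.
  by rewrite -XY mxE big_mkord; apply: eq_bigr => k _; rewrite /x /y inord_val.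
pose D (z : 'I_n -> nat -> F) p q := det4 (quad4 (z e) (z f) (z p) (z q)).
pose m p q r s := minor4 int M (quad4 e f p q) (quad4 e f r s).
have mE p q r s : (m p q r s)%:~R = D x p q * D y r s.
  rewrite /m /minor4 (rmorph_det4 intr) -[D y _ _]det4_tr -det4M.
  apply: det4_ext => u v u4 v4; rewrite -[RHS]/(\sum_(0 <= k < 4) _).
  have quadz (z : 'I_n -> nat -> F) p' q' w : (w < 4)%N ->
      quad4 (z e) (z f) (z p') (z q') w = z (quad4 e f p' q' w).
    by rewrite /quad4; case: w => [|[|[|[|]]]].
  by rewrite rmorph_nat Mxy; apply: eq_bigr => k _; rewrite !quadz.
have gm p q : g p q = m p q p q by [].
have pl z : D z a b * D z c d - D z a c * D z b d + D z a d * D z b c = 0 by exact: plucker.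
clearbody D m g; exists (m a b a d * m c d b c - m a d a b * m b c c d).
apply: (@intr_inj F).
have -> (u v w : int) : (heron u v w)%:~R = heron u%:~R v%:~R w%:~R :> F.
  by rewrite /heron !(rmorphB, rmorphD, rmorphM, rmorphXn, rmorphMn).
rewrite rmorphXn rmorphB !rmorphM /= !gm !mE !(mulrACA (D x _ _) (D y _ _)).
by rewrite (heronE (pl x) (pl y)); congr (_ ^+ 2); ring.
Qed.

(** Values from 49 on are not examined: [heron] takes no value above 45 on the products that
    occur below. *)
Definition square_or_large (h : int) : bool :=
  (49 <= h) || (h \in [:: 0; 1; 4; 9; 16; 25; 36 : int]).

Lemma sqr_square_or_large (k : int) : square_or_large (k ^+ 2).
Proof.
rewrite -(real_normK (num_real k)) -abszE; move: `|k|%N => n.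
case: (ltnP n 7) => n7; last by apply/orP; left; nia.
by case: n n7 => [|[|[|[|[|[|[|]]]]]]].
Qed.

Lemma heron_square_two_twos_check : let T := [:: 1; 2; 3 : int] in
  all (fun a => all (fun a' => all (fun b => all (fun b' => all (fun c => all (fun c' =>
    square_or_large (heron (a * a') (b * b') (c * c')) ==>
    (count_mem (2 : int) [:: a; a'; b; b'; c; c'] == 2%N)) T) T) T) T) T) T.
Proof. by vm_compute. Qed.

(** Up to order, the only triples of products of two numbers from 1, 2, 3 at which Heron's
    polynomial is a square are (1, 1, 4), (1, 2, 6), (1, 4, 9) and (2, 2, 9); exactly two of
    the six factors of each of them are equal to 2. *)
Lemma two_twos (a a' b b' c c' k : int) :
    all (mem [:: 1; 2; 3 : int]) [:: a; a'; b; b'; c; c'] ->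
    heron (a * a') (b * b') (c * c') = k ^+ 2 ->
  count_mem (2 : int) [:: a; a'; b; b'; c; c'] = 2%N.
Proof.
move=> /and5P[Ta Ta' Tb Tb' /and3P[Tc Tc' _]] hk.
have sq : square_or_large (heron (a * a') (b * b') (c * c')).
  by rewrite hk sqr_square_or_large.
have /allP/(_ _ Ta)/allP/(_ _ Ta')/allP/(_ _ Tb) := heron_square_two_twos_check.
by move=> /allP/(_ _ Tb')/allP/(_ _ Tc)/allP/(_ _ Tc')/implyP/(_ sq)/eqP.
Qed.

(** Suppose that there is no such cycle. The minors on vertex 5 and three of the vertices
    0, ..., 4 then take the values 1, 2, 3, and by [two_twos] exactly two of the six that
    involve a given vertex f are equal to 2. Each 3-subset is counted by three
    vertices f, so three times the number of minors equal to 2 would be 10. *)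
Lemma exists_chordless4 (F : realFieldType) (M : 'M[bool]_6) :
    oriented M -> (\rank (mx01 F M) = 4)%N ->
  exists p q r s, uniq [:: p; q; r; s] /\ chordless4 (fun i j => M i j) p q r s.
Proof.
move=> oM rkM.
case: (pickP (fun t : 'I_6 * 'I_6 * 'I_6 * 'I_6 => let: (p, q, r, s) := t in
  uniq [:: p; q; r; s] && chordless4 (fun i j => M i j) p q r s)).
  by move=> [[[p q] r] s] /andP[]; exists p, q, r, s.
move=> none; exfalso.
have nocyc p q r s : uniq [:: p; q; r; s] -> ~~ chordless4 (fun i j => M i j) p q r s.
  by move=> upqrs; have /negbT := none (p, q, r, s); rewrite upqrs.
pose v k : 'I_6 := inord k.
have uv s : all (gtn 6) s -> uniq s -> uniq (map v s).
  move=> /allP s6 us; rewrite map_inj_in_uniq // => i j /s6 i6 /s6 j6 /(congr1 val).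
  by rewrite /= !inordK.
pose g i j k := pminor4 M (v 5%N) (v i) (v j) (v k).
pose ok i j k := all (gtn 6) [:: 5; i; j; k]%N && uniq [:: 5; i; j; k]%N.
have gsmall i j k : ok i j k -> g i j k \in [:: 1; 2; 3 : int].
  by move=> /andP[ijk6 uijk]; apply: pminor_small => //; exact: (uv [:: 5; i; j; k]%N).
pose h i j k : nat := g i j k == 2.
have count2 f a b c d :
    [&& ok f a b, ok f c d, ok f a c, ok f b d, ok f a d & ok f b c] ->
  (h f a b + (h f c d + (h f a c + (h f b d + (h f a d + h f b c)))) = 2)%N.
  case/and5P=> ab cd ac bd /andP[ad bc].
  have [k hk] := heron_pminor4 (v 5%N) (v f) (v a) (v b) (v c) (v d) rkM.
  have := two_twos _ hk; rewrite /= addn0; apply.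
  by rewrite /= !gsmall.
have h23 i j k : h j i k = h i j k by rewrite /h /g pminor4_swap23.
have h34 i j k : h i k j = h i j k by rewrite /h /g pminor4_swap34.
have c0 := count2 0%N 1%N 2%N 3%N 4%N isT.
have c1 := count2 1%N 0%N 2%N 3%N 4%N isT.
have c2 := count2 2%N 0%N 1%N 3%N 4%N isT.
have c3 := count2 3%N 0%N 1%N 2%N 4%N isT.
have c4 := count2 4%N 0%N 1%N 2%N 3%N isT.
move: c0 c1 c2 c3 c4.
rewrite !(h23 0 1, h23 0 2, h23 0 3, h23 0 4, h23 1 2, h23 1 3, h23 1 4, h23 2 3, h23 2 4)%N.
rewrite !(h34 0 1 2, h34 0 1 3, h34 0 1 4, h34 0 2 3, h34 0 2 4, h34 0 3 4)%N.
rewrite !(h34 1 2 3, h34 1 2 4, h34 1 3 4, h34 2 3 4)%N.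
clearbody h; clear; lia.
Qed.

(** * Kernel vectors and enumerations of the vertices *)

(** The condition w z = 0 lowers the dimension of the kernel by at most one. *)
Lemma kernel_vanishing_at (F : fieldType) m n (A : 'M[F]_(m, n)) (z : 'I_n) :
    ((\rank A).+1 < n)%N ->
  exists w : 'I_n -> F,
    [/\ w z = 0, exists t, w t != 0 & forall s, \sum_t A s t * w t = 0].
Proof.
move=> rkA; pose B := col_mx A (delta_mx 0 z : 'rV_n).
have rkB : (\rank B < n)%N.
  rewrite -addsmxE; apply: leq_ltn_trans (mxrank_adds_leqif _ _) _.
  by rewrite mxrank_delta addn1.
have /rowV0Pn [v /sub_kermxP vB v0] : kermx B^T != 0.
  by rewrite -mxrank_eq0 mxrank_ker mxrank_tr subn_eq0 -ltnNge.
have {vB} : B *m v^T = 0 by apply: trmx_inj; rewrite trmx_mul trmxK vB trmx0.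
move=> /eqP; rewrite mul_col_mx col_mx_eq0 => /andP[/eqP Av /eqP zv].
exists (v 0); split.
- have /matrixP/(_ 0 0) := zv; rewrite !mxE (bigD1 z) //= !mxE !eqxx mul1r.
  by rewrite big1 ?addr0 // => t tz; rewrite !mxE (negPf tz) andbF mul0r.
- by have /rV0Pn := v0.
move=> s; have /matrixP/(_ s 0) := Av; rewrite !mxE => Avs; rewrite -[RHS]Avs.
by apply: eq_bigr => t _; rewrite mxE.
Qed.

Lemma uniq_covers n (s : seq 'I_n) : uniq s -> size s = n -> s =i 'I_n.
Proof.
move=> us szs; apply/subset_cardP; last exact/subset_predT.
by rewrite (card_uniqP us) card_ord.
Qed.

Lemma sum_over_uniq (V : nmodType) n (s : seq 'I_n) (f : 'I_n -> V) :
  uniq s -> size s = n -> \sum_t f t = \sum_(t <- s) f t.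
Proof.
move=> us szs; apply: perm_big; apply: uniq_perm; rewrite ?index_enum_uniq //.
by move=> t; rewrite mem_index_enum (uniq_covers us).
Qed.

Lemma exists_notin n (s : seq 'I_n) : (size s < n)%N -> exists x, x \notin s.
Proof.
move=> szs; apply/existsP; rewrite -[[exists _, _]]negbK; apply/negP.
rewrite negb_exists => /forallP sall.
have := card_size s; rewrite leqNgt -(@eq_card _ 'I_n) ?card_ord ?szs // => x.
by have := sall x; rewrite negbK => ->.
Qed.

(** * The two vertices outside a chordless 4-cycle *)

Definition outs (M : 'M[bool]_6) (s : seq 'I_6) z : seq bool := [seq M z t | t <- s].

Definition ins (M : 'M[bool]_6) (s : seq 'I_6) z : seq bool := [seq M t z | t <- s].

(** Orthogonality of an indicator vector on the 4-cycle to (1, -1, 1, -1). *)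
Definition balanced (o : seq bool) : bool :=
  let c := nth false o in (c 0 + c 2 == c 1 + c 3)%N.

Lemma kernel_rows (F : realFieldType) (M : 'M[bool]_6) (i j k l x y : 'I_6) (w : 'I_6 -> F) :
    oriented M -> uniq [:: i; j; k; l; x; y] -> chordless4 (fun i j => M i j) i j k l ->
    (forall s, \sum_t (mx01 F M) s t * w t = 0) ->
  [/\ [/\ w i + w j + (M i x)%:R * w x + (M i y)%:R * w y = 0,
          w j + w k + (M j x)%:R * w x + (M j y)%:R * w y = 0,
          w k + w l + (M k x)%:R * w x + (M k y)%:R * w y = 0
        & w l + w i + (M l x)%:R * w x + (M l y)%:R * w y = 0],
      (M x i)%:R * w i + (M x j)%:R * w j + (M x k)%:R * w k + (M x l)%:R * w l
        + w x + (M x y)%:R * w y = 0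
    & (M y i)%:R * w i + (M y j)%:R * w j + (M y k)%:R * w k + (M y l)%:R * w l
        + w y + (M y x)%:R * w x = 0].
Proof.
move=> [Mdiag Masym] vs cyc kw.
have row s : (M s i)%:R * w i + (M s j)%:R * w j + (M s k)%:R * w k
    + (M s l)%:R * w l + (M s x)%:R * w x + (M s y)%:R * w y = 0.
  by rewrite -[RHS](kw s) (sum_over_uniq _ vs) // !big_cons big_nil !mxE; ring.
have no p q : M p q -> p != q -> M q p = false.
  by move=> Mpq pq; have := Masym _ _ pq; rewrite Mpq => /negPf.
move: cyc vs => /and5P[ij jk kl li /and4P[/negPf ik /negPf ki /negPf jl /negPf lj]].
rewrite /= !inE !negb_or => /and5P[/and5P[nij _ nil _ _] /and4P[njk _ _ _] /and3P[nkl _ _] _ _].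
rewrite eq_sym in nil.
have [[[ji kj] lk] il] := (no _ _ ij nij, no _ _ jk njk, no _ _ kl nkl, no _ _ li nil).
have Me := (Mdiag, ij, jk, kl, li, ik, ki, jl, lj, ji, kj, lk, il).
split; [split|..]; [rewrite -[RHS](row i)|rewrite -[RHS](row j)|rewrite -[RHS](row k)|
  rewrite -[RHS](row l)|rewrite -[RHS](row x)|rewrite -[RHS](row y)]; rewrite !Me /=; ring.
Qed.

Definition alternating (b : seq bool) : int :=
  let b := nth false b in (b 0%N)%:Z - (b 1%N)%:Z + (b 2%N)%:Z - (b 3%N)%:Z.

(** A balanced set o of vertices of the 4-cycle is a disjoint union of pairs of consecutive
    vertices; the value is the sum of b over the first vertices of these pairs. *)
Definition multiplier (o b : seq bool) : nat :=
  let o := nth false o in let b k : nat := nth false b k in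
  (if o 0 then if o 2 then b 0 + b 2 else if o 1 then b 0 else b 3
   else if o 2 then if o 1 then b 1 else b 2 else 0)%N.

(** The row of x expresses - w x - d * w y as the sum of w over the out-neighbours of x on the
    cycle, where d tells whether x has an arc to y. These neighbours split into pairs of
    consecutive vertices, and the row of the first vertex of a pair gives the sum of w over
    this pair, in terms of w y only because that vertex has no arc to x. *)
Lemma multiplier_row (F : realFieldType) (o0 o1 o2 o3 a0 a1 a2 a3 b0 b1 b2 b3 d : bool)
    (w0 w1 w2 w3 wx wy : F) :
    balanced [:: o0; o1; o2; o3] ->
    [&& ~~ (o0 && a0), ~~ (o1 && a1), ~~ (o2 && a2) & ~~ (o3 && a3)] ->
    [/\ w0 + w1 + a0%:R * wx + b0%:R * wy = 0, w1 + w2 + a1%:R * wx + b1%:R * wy = 0,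
        w2 + w3 + a2%:R * wx + b2%:R * wy = 0 & w3 + w0 + a3%:R * wx + b3%:R * wy = 0] ->
    o0%:R * w0 + o1%:R * w1 + o2%:R * w2 + o3%:R * w3 + wx + d%:R * wy = 0 ->
  wx = ((multiplier [:: o0; o1; o2; o3] [:: b0; b1; b2; b3])%:Z - d%:Z)%:~R * wy.
Proof.
rewrite rmorphB /= -!pmulrn /multiplier /= => bal /and4P[A0 A1 A2 A3] [r0 r1 r2 r3].
move: bal A0 A1 A2 A3; case: o0; case: o1; case: o2; case: o3 => //= _;
  case: a0 r0 => //= r0 _; case: a1 r1 => //= r1 _; case: a2 r2 => //= r2 _;
  case: a3 r3 => //= r3 _ r; rewrite ?natrD; lra.
Qed.

(** The alternating sum of the rows of the cycle involves the columns x and y only. If its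
    coefficient at x, say, is not 0, then a kernel vector that vanishes at y also vanishes
    at x. It is therefore alternating on the cycle, and the rows of x and y say that the
    out-neighbourhoods are balanced. If both coefficients are 0, then the in-neighbourhoods
    are balanced. *)
Lemma balanced_outs_or_ins (F : realFieldType) (M : 'M[bool]_6) (i j k l x y : 'I_6) :
    oriented M -> (\rank (mx01 F M) = 4)%N ->
    uniq [:: i; j; k; l; x; y] -> chordless4 (fun i j => M i j) i j k l ->
  (balanced (outs M [:: i; j; k; l] x) && balanced (outs M [:: i; j; k; l] y)) ||
  (balanced (ins M [:: i; j; k; l] x) && balanced (ins M [:: i; j; k; l] y)).
Proof.
move=> oM rkM vs cyc; pose c := [:: i; j; k; l]; rewrite -/c.
have kernel z : exists w : 'I_6 -> F, [/\ w z = 0, exists t, w t != 0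
      & forall s, \sum_t mx01 F M s t * w t = 0].
  by apply: kernel_vanishing_at; rewrite rkM.
have alternating_balanced b0 b1 b2 b3 :
    balanced [:: b0; b1; b2; b3] = (b0%:R - b1%:R + b2%:R - b3%:R == 0 :> F).
  rewrite /balanced /= -(eqr_nat F) !natrD -subr_eq0; congr (_ == 0); ring.
have outs_balanced (w : 'I_6 -> F) : (exists t, w t != 0) ->
    (forall s, \sum_t mx01 F M s t * w t = 0) -> w x = 0 -> w y = 0 ->
    balanced (outs M c x) && balanced (outs M c y).
  move=> [t wt0] kw wx0 wy0; have [[ri rj rk _] rx ry] := kernel_rows oM vs cyc kw.
  rewrite wx0 wy0 in ri rj rk rx ry.
  have wj : w j = - w i by lra.
  have wk : w k = w i by lra.
  have wl : w l = - w i by lra.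
  have wi0 : w i != 0.
    apply: contra_neq wt0 => wi0.
    have : t \in [:: i; j; k; l; x; y] by rewrite (uniq_covers vs).
    by rewrite !inE => /or4P[| | |/or3P[]] /eqP->; rewrite ?wj ?wk ?wl ?wi0 ?oppr0.
  rewrite /outs /c /= !alternating_balanced.
  by apply/andP; split; apply/eqP; apply: (mulIf wi0); rewrite mul0r;
    [rewrite -[RHS]rx | rewrite -[RHS]ry]; rewrite wj wk wl; ring.
have alt_ins (w : 'I_6 -> F) : (forall s, \sum_t mx01 F M s t * w t = 0) ->
    ((M i x)%:R - (M j x)%:R + (M k x)%:R - (M l x)%:R) * w x
    + ((M i y)%:R - (M j y)%:R + (M k y)%:R - (M l y)%:R) * w y = 0.
  by move=> /(kernel_rows oM vs cyc)[[ri rj rk rl] _ _]; lra.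
have [bx|] := boolP (balanced (ins M c x)); last first.
  rewrite [balanced _]alternating_balanced => ax0.
  have [w [wy0 w0 kw]] := kernel y; rewrite (outs_balanced w) //.
  by have /eqP := alt_ins w kw; rewrite wy0 mulr0 addr0 mulf_eq0 (negPf ax0) => /eqP.
have [_|] := boolP (balanced (ins M c y)); first by rewrite orbT.
rewrite [balanced _]alternating_balanced => ay0.
have [w [wx0 w0 kw]] := kernel x; rewrite (outs_balanced w) //.
by have /eqP := alt_ins w kw; rewrite wx0 mulr0 add0r mulf_eq0 (negPf ay0) => /eqP.
Qed.

(** * Recognising the circulant matrix *)

Lemma equiv_C6_of_arcs (M : 'M[bool]_6) (p0 p1 p2 p3 p4 p5 : 'I_6) :
    oriented M -> uniq [:: p0; p1; p2; p3; p4; p5] ->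
    [&& M p0 p1, M p1 p2, M p2 p3, M p3 p4, M p4 p5 & M p5 p0] ->
    [&& M p0 p2, M p1 p3, M p2 p4, M p3 p5, M p4 p0 & M p5 p1] ->
    [&& ~~ M p0 p3, ~~ M p1 p4, ~~ M p2 p5, ~~ M p3 p0, ~~ M p4 p1 & ~~ M p5 p2] ->
  equiv_mx M C6.
Proof.
move=> [Mdiag Masym] up.
pose t := nth p0 [:: p0; p1; p2; p3; p4; p5].
have t_inj : injective (fun a : 'I_6 => t a).
  by move=> a b /eqP; rewrite nth_uniq // => /eqP/val_inj.
move=> /and5P[r01 r12 r23 r34 /andP[r45 r50]] /and5P[r02 r13 r24 r35 /andP[r40 r51]].
move=> /and5P[n03 n14 n25 n30 /andP[n41 n52]].
have no (u v : nat) : (u < 6)%N -> (v < 6)%N -> u != v -> M (t u) (t v) -> M (t v) (t u) = false.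
  move=> u6 v6 uv Muv; have := Masym (t u) (t v).
  by rewrite nth_uniq // Muv => /(_ uv)/negPf.
have MC6 (a b : 'I_6) : M (t a) (t b) = C6 a b.
  rewrite mxE.
  by case: a => [[|[|[|[|[|[|//]]]]]] /= _]; case: b => [[|[|[|[|[|[|//]]]]]] /= _];
   first [exact: Mdiag | exact: negPf | exact: no | by []].
exists (perm t_inj)^-1%g, (perm t_inj)^-1%g; left.
have tK a : t ((perm t_inj)^-1%g a) = a by rewrite -[LHS](permE t_inj) permKV.
by apply/matrixP => a b; rewrite 2!mxE -MC6 !tK.
Qed.

Lemma chordless4_rot (T : Type) (r : T -> T -> bool) i j k l :
  chordless4 r i j k l -> chordless4 r j k l i.
Proof.
by rewrite /chordless4 => /and5P[-> -> -> -> /and4P[-> -> -> ->]].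
Qed.

Lemma uniq_rot4 (T : eqType) (i j k l : T) s : uniq [:: i, j, k, l & s] -> uniq [:: j, k, l, i & s].
Proof.
by rewrite (perm_uniq (permEl (perm_catCA [:: i] [:: j; k; l] s))).
Qed.

Lemma equiv_C6_of_neighbours (M : 'M[bool]_6) (i j k l x y : 'I_6) :
    oriented M -> uniq [:: i; j; k; l; x; y] -> chordless4 (fun i j => M i j) i j k l ->
    [/\ outs M [:: i; j; k; l] x = [:: true; true; false; false],
        ins M [:: i; j; k; l] x = [:: false; false; true; true],
        outs M [:: i; j; k; l] y = [:: false; false; true; true],
        ins M [:: i; j; k; l] y = [:: true; true; false; false]
      & ~~ M x y && ~~ M y x] ->
  equiv_mx M C6.
Proof.
move=> oM vs /and5P[ij jk kl li /and4P[ik ki jl lj]].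
case=> -[xi xj xk xl] [ix jx kx lx] [yi yj yk yl] [iy jy ky ly] /andP[xy yx].
(* The circular order in which every vertex has arcs to the next two. *)
apply: (@equiv_C6_of_arcs M x i j y k l) => //; last first.
- by rewrite xy ik jl yx ki lj.
- by rewrite xj iy jk yl kx li.
- by rewrite xi ij jy yk kl lx.
move: vs; rewrite -(perm_uniq (s1 := [:: x; i; j; y; k; l])) //.
apply/seq.permP => p /=.
by move: (p i : nat) (p j : nat) (p k : nat) (p l : nat) (p x : nat) (p y : nat); clear; lia.
Qed.

(** The list s holds the pairs (arc from x, arc to x) for the four cycle vertices, the same for
    y, and the pair of possible arcs from x to y and from y to x. The premise adds to the
    balance of the out-neighbourhoods what a kernel vector w says, with w x = cx * w y and
    w y = cy * w x; the conclusion describes [C6] up to the choice of the first vertex of the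
    cycle. *)
Definition C6_pattern (s : seq (bool * bool)) : bool :=
  let x := take 4 s in let y := take 4 (drop 4 s) in let d := nth (false, false) s 8 in
  let ox := unzip1 x in let a := unzip2 x in
  let oy := unzip1 y in let b := unzip2 y in
  let cx := (multiplier ox b)%:Z - d.1%:Z in let cy := (multiplier oy a)%:Z - d.2%:Z in
  [&& balanced ox, balanced oy, cx * cy == 1 & alternating a * cx + alternating b == 0] ==>
  [&& d == (false, false), a == oy, b == ox, oy == map negb ox
    & has (fun r => ox == rot r [:: true; true; false; false]) (iota 0 4)].

Lemma C6_pattern_check : all_arcs 9 C6_pattern.
Proof. by vm_compute. Qed.

(** A kernel vector that vanishes at i cannot vanish at both x and y, for it would then be zero
    along the cycle. Its values at x and y are integer multiples of each other; with the
    alternating sum of the rows of the cycle this gives the premise of [C6_pattern]. *)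
Lemma balanced_outs_equiv_C6 (F : realFieldType) (M : 'M[bool]_6) (i j k l x y : 'I_6) :
    oriented M -> (\rank (mx01 F M) = 4)%N ->
    uniq [:: i; j; k; l; x; y] -> chordless4 (fun i j => M i j) i j k l ->
    balanced (outs M [:: i; j; k; l] x) -> balanced (outs M [:: i; j; k; l] y) ->
  equiv_mx M C6.
Proof.
move=> oM rkM vs cyc balx baly.
have [|w [wi0 [t wt0] kw]] := @kernel_vanishing_at _ _ _ (mx01 F M) i; first by rewrite rkM.
have [[ri rj rk rl] rx ry] := kernel_rows oM vs cyc kw.
have asym p q : p != q -> ~~ (M p q && M q p) by case: oM => _; apply.
have vs' := vs; move: vs'; rewrite /= !inE !negb_or.
case/and5P=> /and5P[nij nik nil nix niy] /and4P[njk njl njx njy] /and3P[nkl nkx nky].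
case/andP=> nlx nly /andP[nxy _].
have ex : w x = ((multiplier (outs M [:: i; j; k; l] x) (ins M [:: i; j; k; l] y))%:Z
                 - (M x y)%:Z)%:~R * w y.
  by apply: (multiplier_row balx _ (And4 ri rj rk rl) rx); rewrite /= !asym // eq_sym.
have ey : w y = ((multiplier (outs M [:: i; j; k; l] y) (ins M [:: i; j; k; l] x))%:Z
                 - (M y x)%:Z)%:~R * w x.
  have swap (a b c d : F) : a + b + c + d = 0 -> a + b + d + c = 0 by rewrite addrAC.
  apply: (multiplier_row baly _ (And4 (swap _ _ _ _ ri) (swap _ _ _ _ rj)
                                      (swap _ _ _ _ rk) (swap _ _ _ _ rl)) ry).
  by rewrite /= !asym // eq_sym.
have wy0 : w y != 0.
  apply: contra_neq wt0 => wy0; have wx0 : w x = 0 by rewrite ex wy0 mulr0.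
  rewrite wx0 wy0 wi0 !mulr0 !addr0 add0r in ri rl rj rk *.
  have : t \in [:: i; j; k; l; x; y] by rewrite (uniq_covers vs).
  rewrite ri add0r in rj; rewrite rj add0r in rk.
  by rewrite !inE => /or4P[| | |/or3P[]] /eqP->.
set cx := _ - (M x y)%:Z in ex; set cy := _ - (M y x)%:Z in ey.
have cxy : cx * cy = 1.
  apply: (@intr_inj F); apply: (mulIf wy0); rewrite rmorphM /= mul1r [RHS]ey ex; ring.
have alt : alternating (ins M [:: i; j; k; l] x) * cx + alternating (ins M [:: i; j; k; l] y) = 0.
  apply: (@intr_inj F); apply: (mulIf wy0).
  rewrite rmorphD rmorphM /= mulrDl -mulrA -ex mul0r.
  rewrite /alternating /= !(rmorphB, rmorphD) /= -!pmulrn.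
  lra.
pose s := zip (outs M [:: i; j; k; l] x) (ins M [:: i; j; k; l] x)
       ++ zip (outs M [:: i; j; k; l] y) (ins M [:: i; j; k; l] y) ++ [:: (M x y, M y x)].
have sarcs : all (fun a => ~~ (a.1 && a.2)) s.
  by rewrite /= !asym // eq_sym.
have : C6_pattern s by apply: all_arcsP sarcs => //; exact: C6_pattern_check.
move=> /implyP; rewrite [balanced _]balx [balanced (unzip1 (take 4 (drop 4 _)))]baly.
rewrite [_ * _ == 1](introT eqP cxy) [_ + _ == 0](introT eqP alt) => /(_ isT).
case/and5P=> /eqP[xy yx] /eqP ax /eqP bx /eqP oy /hasP[r].
rewrite -[unzip1 _]/(outs M [:: i; j; k; l] x) => r4 /eqP ox.
rewrite -[unzip1 _]/(outs M [:: i; j; k; l] y) -[unzip1 _]/(outs M [:: i; j; k; l] x) ox in oy.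
rewrite -[unzip2 _]/(ins M [:: i; j; k; l] x) -[unzip1 _]/(outs M [:: i; j; k; l] y) oy in ax.
rewrite -[unzip2 _]/(ins M [:: i; j; k; l] y) -[unzip1 _]/(outs M [:: i; j; k; l] x) ox in bx.
clear -oM vs cyc xy yx ox oy ax bx r4.
(* The out-neighbourhood of x is a pair of consecutive vertices of the cycle; the cycle is
   renamed so that this pair comes first. *)
case: r r4 ox oy ax bx =>
  [|[|[|[|//]]]] _ [xi xj xk xl] [yi yj yk yl] [ix jx kx lx] [iy jy ky ly];
have arcs := (xi, xj, xk, xl, yi, yj, yk, yl, ix, jx, kx, lx, iy, jy, ky, ly, xy, yx).
- by apply: (equiv_C6_of_neighbours oM vs cyc); split; rewrite /outs /ins /= !arcs.
- have vs1 := uniq_rot4 (uniq_rot4 (uniq_rot4 vs)).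
  have cyc1 := chordless4_rot (chordless4_rot (chordless4_rot cyc)).
  by apply: (equiv_C6_of_neighbours oM vs1 cyc1); split; rewrite /outs /ins /= !arcs.
- have vs2 := uniq_rot4 (uniq_rot4 vs).
  have cyc2 := chordless4_rot (chordless4_rot cyc).
  by apply: (equiv_C6_of_neighbours oM vs2 cyc2); split; rewrite /outs /ins /= !arcs.
- have vs3 := uniq_rot4 vs; have cyc3 := chordless4_rot cyc.
  by apply: (equiv_C6_of_neighbours oM vs3 cyc3); split; rewrite /outs /ins /= !arcs.
Qed.

(** * Equivalence of matrices and the rank of the circulant matrix *)

Lemma oriented_tr n (M : 'M[bool]_n) : oriented M -> oriented M^T.
Proof.
by move=> [dM aM]; split=> [i|i j ij]; rewrite !mxE // aM // eq_sym.
Qed.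

Lemma mx01_tr (R : nzRingType) m n (M : 'M[bool]_(m, n)) : mx01 R M^T = (mx01 R M)^T.
Proof. by apply/matrixP => i j; rewrite !mxE. Qed.

Lemma equiv_mx_tr n (M N : 'M[bool]_n) : equiv_mx M^T N -> equiv_mx M N.
Proof.
move=> [s [t [] /(congr1 trmx)]]; rewrite trmxK tr_row_perm tr_col_perm => ->.
  by exists t, s; right; rewrite col_row_permC.
by exists t, s; left; rewrite trmxK col_row_permC.
Qed.

Lemma equiv_mx_col_perm n (M N : 'M[bool]_n) (c : 'S_n) :
  equiv_mx (col_perm c M) N -> equiv_mx M N.
Proof.
have MK (A : 'M[bool]_n) : col_perm c M = A -> M = col_perm c^-1%g A.
  by move=> <-; rewrite -col_permM mulVg col_perm1.
move=> [s [t [] /MK->]]; exists s, (c^-1 * t)%g; [left|right];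
  by rewrite -col_row_permC -col_permM col_row_permC.
Qed.

Lemma rank_perm (R : fieldType) m n (M : 'M[bool]_(m, n)) s t :
  \rank (mx01 R (row_perm s (col_perm t M))) = \rank (mx01 R M).
Proof.
rewrite /mx01 map_row_perm map_col_perm row_permE col_permE.
have full : row_full (perm_mx s : 'M[R]_m) by rewrite row_full_unit unitmx_perm.
by rewrite (eqmxMfull _ full) mxrankMfree // row_free_unit unitmx_perm.
Qed.

Lemma oriented_C6 : oriented C6.
Proof.
split=> [i|i j]; first by rewrite mxE; case: i => [[|[|[|[|[|[|//]]]]]] ?].
by rewrite !mxE; case: i j => [[|[|[|[|[|[|//]]]]]] ?] [[|[|[|[|[|[|//]]]]]] ?].
Qed.

Lemma rank_C6 (F : realFieldType) : \rank (mx01 F C6) = 4%N.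
Proof.
apply/eqP; rewrite eqn_leq; apply/andP; split.
  (* The last two rows are r0 - r1 + r3 and r0 - r2 + r3. *)
  pose L : 'M[F]_(6, 4) := \matrix_(i, j) (nth 0 (nth [::]
    [:: [:: 1; 0; 0; 0]; [:: 0; 1; 0; 0]; [:: 0; 0; 1; 0]; [:: 0; 0; 0; 1];
        [:: 1; -1; 0; 1]; [:: 1; 0; -1; 1]] i) j).
  pose w := widen_ord (isT : (4 <= 6)%N).
  suff -> : mx01 F C6 = L *m rowsub w (mx01 F C6).
    exact: leq_trans (mxrankM_maxl _ _) (rank_leq_col _).
  apply/matrixP => i j; rewrite !mxE !big_ord_recl big_ord0 !mxE.
  by case: i => [[|[|[|[|[|[|//]]]]]] ?]; case: j => [[|[|[|[|[|[|//]]]]]] ?] /=;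
    rewrite /bump /=; ring.
pose w := widen_ord (isT : (4 <= 6)%N).
(* The leading 4 x 4 block is upper triangular with a unit diagonal. *)
pose T := rowsub w (colsub w (mx01 F C6)).
have rkT : (\rank T <= \rank (mx01 F C6))%N.
  apply: leq_trans (mxrankS (rowsub_sub _ _)) _.
  by rewrite -mxrank_tr trmx_mxsub -[leqRHS]mxrank_tr mxrankS // rowsub_sub.
apply: leq_trans rkT; suff T1 : \det T = 1 by rewrite mxrank_unit // unitmxE T1 unitr1.
rewrite -det_tr det_trig; first by rewrite !big_ord_recl big_ord0 !mxE /= !mulr1.
by apply/is_trig_mxP => -[[|[|[|[|//]]]] ?] [[|[|[|[|//]]]] ?] //= _; rewrite !mxE.
Qed.

Lemma oriented_equiv_C6 (F : realFieldType) (M : 'M[bool]_6) :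
  oriented M -> (\rank (mx01 F M) = 4)%N -> equiv_mx M C6.
Proof.
move=> oM rkM; have [i [j [k [l [us cyc]]]]] := exists_chordless4 oM rkM.
have [x xN] := @exists_notin _ [:: i; j; k; l] isT.
have [y yN] := @exists_notin _ [:: x; i; j; k; l] isT.
have vs : uniq [:: i; j; k; l; x; y].
  rewrite -[[:: _; _; _; _; _; _]]/([:: i; j; k; l] ++ [:: x; y]) cat_uniq us.
  move: yN; rewrite inE negb_or => /andP[yx yN].
  by rewrite /= orbF negb_or xN yN inE eq_sym yx.
have [/andP[bx b_y]|/andP[bx b_y]] := orP (balanced_outs_or_ins oM rkM vs cyc).
  exact: balanced_outs_equiv_C6 oM rkM vs cyc bx b_y.
(* Transposition reverses the arcs, hence also the direction of the cycle. *)
apply: equiv_mx_tr; apply: (@balanced_outs_equiv_C6 F _ l k j i x y).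
- exact: oriented_tr.
- by rewrite mx01_tr mxrank_tr.
- have rev_perm : perm_eq (rev [:: i; j; k; l] ++ [:: x; y]) ([:: i; j; k; l] ++ [:: x; y]).
    by rewrite perm_cat2r perm_rev.
  by rewrite [uniq _](perm_uniq rev_perm).
- move: cyc; rewrite /chordless4 !mxE.
  by case/and5P=> -> -> -> -> /and4P[-> -> -> ->].
- by rewrite /outs /balanced /= !mxE eq_sym addnC [eqbRHS]addnC.
- by rewrite /outs /balanced /= !mxE eq_sym addnC [eqbRHS]addnC.
Qed.

(** * Isolation sets and factorization ranks *)

Lemma in_all_one_2x2E m n (M : 'M[bool]_(m, n)) (p q : 'I_m * 'I_n) :
    p.1 != q.1 -> p.2 != q.2 ->
  in_all_one_2x2 M p q = [&& M p.1 p.2, M p.1 q.2, M q.1 p.2 & M q.1 q.2].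
Proof.
move=> pq1 pq2; apply/existsP/and4P.
  move=> [I /existsP[J /and5P[_ _ /'forall_in_'forall_in_idP one]]].
  by rewrite !inE => /andP[pI pJ] /andP[qI qJ]; split; apply: one.
move=> [Mpp Mpq Mqp Mqq]; exists [set p.1; q.1]; apply/existsP; exists [set p.2; q.2].
rewrite !cards2 pq1 pq2 !inE !eqxx !orbT /= !andbT.
by apply/'forall_in_'forall_in_idP => i; rewrite !inE => /orP[]/eqP-> j;
  rewrite !inE => /orP[]/eqP->.
Qed.

Lemma isolation_setP m n (M : 'M[bool]_(m, n)) (S : {set 'I_m * 'I_n}) :
  reflect ((forall p, p \in S -> M p.1 p.2) /\
    forall p q, p \in S -> q \in S -> p != q ->
      [/\ p.1 != q.1, p.2 != q.2 & ~~ (M p.1 q.2 && M q.1 p.2)])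
    (isolation_set M S).
Proof.
apply: (iffP andP) => [[/'forall_in_idP one /'forall_in_'forall_in_implyP iso]|[one iso]].
  split=> // p q pS qS pq; have /and3P[pq1 pq2] := iso _ pS _ qS pq.
  by rewrite in_all_one_2x2E // !one ?andbT //= => ->.
split; first exact/'forall_in_idP.
apply/'forall_in_'forall_in_implyP => p pS q qS pq.
have [pq1 pq2 npq] := iso _ _ pS qS pq.
by rewrite pq1 pq2 in_all_one_2x2E // !one // andbT.
Qed.

Lemma card_isolation_set m n (M : 'M[bool]_(m, n)) S : isolation_set M S -> (#|S| <= m)%N.
Proof.
move=> /isolation_setP[_ iso]; rewrite -[leqRHS]card_ord -(@card_in_imset _ _ fst) ?max_card //.
move=> p q pS qS pq1; apply: contraTeq isT => pq.
by have [] := iso _ _ pS qS pq; rewrite pq1 eqxx.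
Qed.

Lemma isolation_oriented n (M : 'M[bool]_n) (S : {set 'I_n * 'I_n}) :
  isolation_set M S -> #|S| = n -> exists c : 'S_n, oriented (col_perm c M).
Proof.
move=> /isolation_setP[one iso] cardS.
have fst_inj : {in S &, injective fst}.
  move=> p q pS qS pq1; apply: contraTeq isT => pq.
  by have [] := iso _ _ pS qS pq; rewrite pq1 eqxx.
have fstS : fst @: S = setT.
  by apply/eqP; rewrite eqEcard subsetT cardsT card_ord card_in_imset //= cardS.
have [c cS] : exists c : 'I_n -> 'I_n, forall i, (i, c i) \in S.
  apply: (@fin_all_exists _ (fun=> 'I_n) (fun i j => (i, j) \in S)) => i.
  have : i \in fst @: S by rewrite fstS.
  by case/imsetP=> -[i' j] ijS ->; exists j.
have iso' i j : i != j -> c i != c j /\ ~~ (M i (c j) && M j (c i)).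
  move=> ij; have [|/= _ cij nM] := iso _ _ (cS i) (cS j); last by split.
  by apply: contraNneq ij => -[->].
have c_inj : injective c.
  by move=> i j; apply: contra_eq => /iso'[].
exists (perm c_inj); split=> [i|i j /iso'[_]]; rewrite !mxE !permE //.
exact: (one _ (cS i)).
Qed.

Lemma oriented_isolation n (N : 'M[bool]_n) (s t : 'S_n) : oriented N ->
  exists2 S, isolation_set (row_perm s (col_perm t N)) S & #|S| = n.
Proof.
move=> [dN aN]; pose f i := (i, (s * t^-1)%g i).
have tf i : t (f i).2 = s i by rewrite /= permM permKV.
exists (f @: setT); last by rewrite card_imset ?cardsT ?card_ord // => i j [].
apply/isolation_setP; split=> [_ /imsetP[i _ ->]|_ _ /imsetP[i _ ->] /imsetP[j _ ->] fij].
  by rewrite !mxE tf.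
have ij : i != j by apply: contraNneq fij => ->.
split=> //; first by rewrite (inj_eq perm_inj).
by rewrite !mxE !tf aN // (inj_eq perm_inj).
Qed.

(** Each 1-entry needs a witness k among the d inner indices, and two entries of an isolation
    set cannot share one: the rectangle of k would contain the 2 x 2 submatrix they span. *)
Lemma bool_factor_isolation m n (M : 'M[bool]_(m, n)) S d :
  isolation_set M S -> bool_factor M d -> (#|S| <= d)%N.
Proof.
move=> /isolation_setP[one iso] /existsP[A /existsP[B /eqP MAB]].
have factor i j : M i j = [exists k, A i k && B k j] by rewrite MAB mxE.
pose f (p : 'I_m * 'I_n) := [pick k | A p.1 k && B k p.2].
have fS p : p \in S -> exists2 k, f p = Some k & A p.1 k && B k p.2.
  move=> /one; rewrite factor /f => /existsP[k ABk].
  by case: pickP => [k' ABk'|/(_ k)]; [exists k' | rewrite ABk].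
have f_inj : {in S &, injective f}.
  move=> p q pS qS fpq; apply: contraTeq isT => pq.
  have [[k fp /andP[Ap Bp]] [k' fq /andP[Aq Bq]]] := (fS p pS, fS q qS).
  have [_ _] := iso _ _ pS qS pq; move: fpq; rewrite fp fq => -[kk']; rewrite -kk' in Aq Bq.
  rewrite !factor negb_and => /orP[]/existsP[]; exists k; first by rewrite Ap Bq.
  by rewrite Aq Bp.
have -> : d = #|Some @: [set: 'I_d]| by rewrite card_imset ?cardsT ?card_ord // => k k' [].
rewrite -(card_in_imset f_inj).
apply/subset_leq_card/subsetP => _ /imsetP[p pS ->].
by have [k -> _] := fS p pS; apply: imset_f.
Qed.

Lemma bin_bool_factor m n (M : 'M[bool]_(m, n)) d : bin_factor M d -> bool_factor M d.
Proof.
move=> /existsP[A /existsP[B /eqP/matrixP MAB]].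
apply/existsP; exists A; apply/existsP; exists B; apply/eqP/matrixP => i j.
have := MAB i j; rewrite !mxE => Mij.
have {Mij} : (M i j : nat) = (\sum_k (A i k && B k j))%N.
  apply/eqP; rewrite -(eqr_nat int) Mij natr_sum; apply/eqP/eq_bigr => k _.
  by rewrite !mxE -natrM mulnb.
move=> Mij; rewrite -[M i j]lt0b Mij lt0n; apply/idP/existsP => [|[k ABk]].
  by rewrite sum_nat_eq0 negb_forall => /existsP[k]; rewrite eqb0 negbK; exists k.
by rewrite (bigD1 k) //= ABk.
Qed.

Lemma bin_factor_rows m n (M : 'M[bool]_(m, n)) : bin_factor M m.
Proof.
apply/existsP; exists (\matrix_(i, j) (i == j)); apply/existsP; exists M; apply/eqP.
suff -> : mx01 int (\matrix_(i < m, j < m) (i == j)) = 1%:M by rewrite mul1mx.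
by apply/matrixP => i j; rewrite !mxE.
Qed.

Lemma full_isolation_ranks n (M : 'M[bool]_n) S : isolation_set M S -> #|S| = n ->
  [/\ bin_rank M = n, bool_rank M = n & isolation_number M = n].
Proof.
move=> isoS cardS.
have [leS geS] : (bool_rank M <= bin_rank M)%N /\ (bin_rank M <= n)%N.
  rewrite /bool_rank /bin_rank; case: ex_minnP => b fb minb; case: ex_minnP => c fc minc.
  by rewrite minc ?bin_factor_rows // minb ?bin_bool_factor.
have low : (n <= bool_rank M)%N.
  rewrite /bool_rank; case: ex_minnP => b fb _.
  by rewrite -[leqLHS]cardS (bool_factor_isolation isoS).
split; try by apply/eqP; rewrite eqn_leq; lia.
apply/eqP; rewrite eqn_leq; apply/andP; split.
  by apply/bigmax_leqP => T; apply: card_isolation_set.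
by rewrite -[leqLHS]cardS; apply: leq_bigmax_cond.
Qed.

(** * The characterization of the circulant matrix *)

Lemma full_isolation_number_equiv_C6 (F : realFieldType) (M : 'M[bool]_6) :
  (\rank (mx01 F M) = 4)%N -> isolation_number M = 6%N -> equiv_mx M C6.
Proof.
move=> rkM iM.
have [|S isoS cardS] := @eq_bigmax_cond _ (isolation_set M) (fun S => #|S|).
  apply/card_gt0P; exists set0; apply/isolation_setP.
  by split=> p; rewrite inE.
have [c oM] := isolation_oriented isoS (etrans (esym cardS) iM).
apply: (equiv_mx_col_perm (c := c)); apply: (oriented_equiv_C6 (F := F) oM).
by rewrite -[col_perm c M]row_perm1 rank_perm.
Qed.

Lemma equiv_C6_ranks (R : realType) (M : 'M[bool]_6) : equiv_mx M C6 ->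
  [/\ real_rank R M = 4%N, bin_rank M = 6%N, bool_rank M = 6%N & isolation_number M = 6%N].
Proof.
move=> [s [t ME]].
have [N oN [rkN ->]] : exists2 N : 'M[bool]_6, oriented N &
    \rank (mx01 R N) = 4%N /\ M = row_perm s (col_perm t N).
  case: ME => ->; [exists C6 | exists C6^T] => //; rewrite ?mx01_tr ?mxrank_tr ?rank_C6 //.
  - exact: oriented_C6.
  - exact/oriented_tr/oriented_C6.
have [S isoS cardS] := oriented_isolation s t oN.
have [-> -> ->] := full_isolation_ranks isoS cardS.
by split; rewrite // /real_rank rank_perm.
Qed.

Local Close Scope ring_scope.

Theorem corollary21 (R : realType) (M : 'M[bool]_6) :
  [/\ real_rank R M = 4, bin_rank M = 6, bool_rank M = 6
    & isolation_number M = 6] <-> equiv_mx M C6.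
Proof.
split; last exact: equiv_C6_ranks.
by case=> rkM _ _; exact: (full_isolation_number_equiv_C6 (F := R)).
Qed.
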